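(* Among all graphs with exactly $5$ vertices, the complete bipartite graph $K_{2,3}$ is the unique graph (up to isomorphism) that contains a cycle, has an outside-obstacle representation, and has no inside-obstacle representation.
   Context: An obstacle is a topologically open, non-self-intersecting polygonal region in the plane (possibly unbounded). Given an obstacle $C$ and a finite set $P$ of points in general position in the complement of $C$, the visibility graph $G_C(P)$ has vertex set $P$ and an edge $pq$ exactly when $\overline{pq}\cap C=\emptyset$; its straight-line drawing is the visibility drawing. A single-obstacle representation of $G$ is a pair $(P,C)$ with $G\cong G_C(P)$; it is an outside-obstacle representation if $C$ lies in the unbounded component of the complement of the visibility drawing, and an inside-obstacle representation if $C$ lies in the complement of that unbounded component. *)

(* Defs.v *)
From HB Require Import structures.
From mathcomp Require Import all_boot all_order all_algebra.
From mathcomp Require Import all_classical all_reals all_analysis.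
Set Implicit Arguments. Unset Strict Implicit. Unset Printing Implicit Defensive.
Import Order.TTheory GRing.Theory Num.Theory numFieldNormedType.Exports.
Local Open Scope ring_scope.
Local Open Scope classical_set_scope.

Section Plane.
Variable R : realType.

Local Notation point := (R * R)%type.

Definition seg (p q : point) : set point :=
  [set x | exists t : R, 0 <= t <= 1 /\
     x = ((1 - t) * p.1 + t * q.1, (1 - t) * p.2 + t * q.2)].

Definition ray (v d : point) : set point :=
  [set x | exists t : R, 0 <= t /\ x = (v.1 + t * d.1, v.2 + t * d.2)].

Definition chain_simple (m : nat) (piece : nat -> set point)
    (junc : nat -> point) (closed : bool) : Prop :=
  forall i j : nat, (i < j < m)%N ->
    if j == i.+1 then piece i `&` piece j = [set junc i]
    else if closed && (i == 0)%N && (j == m.-1) then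
      piece i `&` piece j = [set junc j]
    else piece i `&` piece j = set0.

Definition chain_set (m : nat) (piece : nat -> set point) : set point :=
  [set x | exists i : nat, (i < m)%N /\ piece i x].

Definition simple_polygon (vs : seq point) (B : set point) : Prop :=
  let n := size vs in
  let v := fun i => nth (0, 0) vs (i %% n) in
  let piece := fun i => seg (v i) (v i.+1) in
  [/\ (3 <= n)%N, uniq vs,
      chain_simple n piece (fun i => v i.+1) true &
      B = chain_set n piece].

Definition simple_open_chain (vs : seq point) (d0 d1 : point) (B : set point)
    : Prop :=
  let n := size vs in
  let v := fun i => nth (0, 0) vs i in
  let piece := fun k =>
    if k == 0%N then ray (v 0%N) d0
    else if k == n then ray (v n.-1) d1
    else seg (v k.-1) (v k) in
  [/\ (1 <= n)%N, uniq vs, (d0 != (0, 0)) && (d1 != (0, 0)),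
      chain_simple n.+1 piece v false &
      B = chain_set n.+1 piece].

(** Obstacle: a topologically open, non-self-intersecting polygonal region,
    i.e. a connected component of the complement of a simple polygonal curve
    (closed polygon, or a simple chain with two unbounded rays). *)
Definition obstacle (C : set point) : Prop :=
  open C /\
  exists B : set point,
    ((exists vs, simple_polygon vs B) \/
     (exists vs d0 d1, simple_open_chain vs d0 d1 B)) /\
    exists x, ~ B x /\ C = connected_component (~` B) x.

Definition collinear (p q r : point) : Prop :=
  (q.1 - p.1) * (r.2 - p.2) - (q.2 - p.2) * (r.1 - p.1) = 0.

Definition bounded_set2 (A : set point) : Prop :=
  exists M : R, forall x, A x -> `|x.1| <= M /\ `|x.2| <= M.

Section Graph.
Variables (V : finType) (adj : rel V).

Definition general_position (f : V -> point) : Prop :=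
  injective f /\
  forall u v w : V, u != v -> v != w -> u != w -> ~ collinear (f u) (f v) (f w).

Definition obstacle_rep (f : V -> point) (C : set point) : Prop :=
  [/\ obstacle C, general_position f,
      (forall u, ~ C (f u)) &
      forall u v, u != v -> (adj u v <-> seg (f u) (f v) `&` C = set0)].

Definition drawing (f : V -> point) : set point :=
  [set x | exists u v, ((u == v) || adj u v) /\ seg (f u) (f v) x].

Definition in_unbounded_face (f : V -> point) (x : point) : Prop :=
  ~ drawing f x /\ ~ bounded_set2 (connected_component (~` drawing f) x).

Definition outside_obstacle_rep (f : V -> point) (C : set point) : Prop :=
  obstacle_rep f C /\ C `<=` in_unbounded_face f.

Definition inside_obstacle_rep (f : V -> point) (C : set point) : Prop :=
  obstacle_rep f C /\ C `<=` ~` in_unbounded_face f.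

Definition has_outside_obstacle_rep : Prop :=
  exists f C, outside_obstacle_rep f C.
Definition has_inside_obstacle_rep : Prop :=
  exists f C, inside_obstacle_rep f C.

End Graph.
End Plane.

Definition simple_graph (V : finType) (adj : rel V) : Prop :=
  symmetric adj /\ irreflexive adj.

Definition has_cycle (V : finType) (adj : rel V) : Prop :=
  exists s : seq V, (3 <= size s)%N /\ uniq s /\ cycle adj s.

Definition graph_iso (V W : finType) (a : rel V) (b : rel W) : Prop :=
  exists h : V -> W, bijective h /\ forall u v, b (h u) (h v) = a u v.

Definition K23 : rel 'I_5 := fun u v => (u < 2)%N != (v < 2)%N.

(* Main.v *)
(* In a drawing of K_{2,3}, let [a1 a2] be the non-edge between the two vertices
   of the small side. If the other three vertices lie on one side of the line
   [a1 a2], an obstacle point on this non-edge escapes to infinity across it.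
   Otherwise two of them, [b1] and [b2], lie on one side and [b3] on the other.
   If [b1] is the one closer to the line, the 4-cycle a1 b1 a2 b3 encloses the
   segment [a1 a2] but not the segment [b1 b2], so a connected obstacle cannot
   meet both. Hence there is no inside representation; an outside one has its
   vertices in convex position, in the hull order a1 a2 b3 b2 b1.

   For each of the 23 other graphs with a cycle an explicit integer
   representation is given and checked by computation. The checker relies on
   the parity of the number of crossings of an upward ray with a closed
   polygonal line, which is constant on connected sets avoiding that line: it
   keeps the obstacle away from the drawing and inside a cycle of the graph. *)
Require Import Defs.
From Stdlib Require Import ZArith.
From HB Require Import structures.
From mathcomp Require Import all_boot all_order all_algebra.
From mathcomp Require Import all_classical all_reals all_analysis.
From mathcomp Require Import ring lra ssrZ.
Set Implicit Arguments. Unset Strict Implicit. Unset Printing Implicit Defensive.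
Import Order.TTheory GRing.Theory Num.Theory numFieldNormedType.Exports.
Local Open Scope ring_scope.
Local Open Scope classical_set_scope.

(** * Segments and connected components *)

Section PlaneTests.
Variable K : realDomainType.
Implicit Types p q r s z : K * K.

(** Twice the signed area of the triangle, positive for a left turn. An arbitrary ordered domain
    lets the same tests run on integers and be interpreted over the reals. *)
Definition orient p q r : K :=
  (q.1 - p.1) * (r.2 - p.2) - (q.2 - p.2) * (r.1 - p.1).

(** A sufficient criterion for disjointness: one segment lies strictly on one side of the line
    through the other. *)
Definition seg_apart p q r s : bool :=
  (0 < orient p q r * orient p q s) || (0 < orient r s p * orient r s q).

Definition seg_cross p q r s : bool :=
  (orient p q r * orient p q s < 0) && (orient r s p * orient r s q < 0).

(* The upward vertical ray from [z] crosses the segment; abscissae are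
   compared half-openly so that a ray through a vertex is counted once. *)
Definition ray_crosses p q z : bool :=
  ((p.1 <= z.1) && (z.1 < q.1) && (orient p q z < 0)) ||
  ((q.1 <= z.1) && (z.1 < p.1) && (0 < orient p q z)).

Fixpoint ray_parity (v : nat -> K * K) (n : nat) z : bool :=
  if n is m.+1 then ray_crosses (v m) (v m.+1) z (+) ray_parity v m z
  else false.

End PlaneTests.

Section PlaneTopology.
Variable R : realType.
Local Notation point := (R * R)%type.
Implicit Types p q r s x y z : point.

Lemma seg_image p q :
  seg p q = (fun t : R => ((1 - t) * p.1 + t * q.1, (1 - t) * p.2 + t * q.2))
              @` `[0, 1].
Proof.
apply/seteqP; split=> x /=.
  by move=> [t [t01 ->]]; exists t => //; rewrite /= in_itv.
by move=> [t]; rewrite /= in_itv /= => t01 <-; exists t.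
Qed.

Lemma continuous_affine_path p q :
  continuous (fun t : R =>
    ((1 - t) * p.1 + t * q.1, (1 - t) * p.2 + t * q.2) : point).
Proof.
have affC (a b : R) : continuous (fun t : R => (1 - t) * a + t * b).
  move=> t; apply: cvgD; apply: cvgM; try exact: cvg_cst; try exact: cvg_id.
  by apply: cvgB; [exact: cvg_cst | exact: cvg_id].
move=> t; exact: (cvg_pair (affC p.1 q.1 t) (affC p.2 q.2 t)).
Qed.

Lemma seg_connected p q : connected (seg p q).
Proof.
rewrite seg_image; apply: connected_continuous_connected.
  exact: segment_connected.
exact/continuous_subspaceT/continuous_affine_path.
Qed.

Lemma seg_closed p q : closed (seg p q).
Proof.
apply: compact_closed; first exact: norm_hausdorff.
rewrite seg_image; apply: continuous_compact; last exact: segment_compact.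
exact/continuous_subspaceT/continuous_affine_path.
Qed.

Lemma seg_left p q : seg p q p.
Proof. by exists 0; rewrite lexx ler01 !mul0r !subr0 !mul1r !addr0 -surjective_pairing. Qed.

Lemma seg_right p q : seg p q q.
Proof. by exists 1; rewrite lexx ler01 !subrr !mul0r !mul1r !add0r -surjective_pairing. Qed.

Lemma chain_set_closed m (piece : nat -> set point) :
  (forall i, closed (piece i)) -> closed (chain_set m piece).
Proof.
move=> clP; have -> : chain_set m piece = \bigcup_(i in `I_m) piece i.
  by apply/seteqP; split=> x /= [i]; [case=> im xi; exists i | move=> im xi; exists i].
by apply: closed_bigcup => [|i _]; [exact: finite_II | exact: clP].
Qed.

Lemma seg_sub_ball x y (e : R) : ball x e y -> seg x y `<=` ball x e.
Proof.
move=> [b1 b2] z [t [/andP[t0 t1] ->]]; split; move: b1 b2;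
  rewrite /ball /= => b1 b2.
  have -> : x.1 - ((1 - t) * x.1 + t * y.1) = t * (x.1 - y.1) by ring.
  by rewrite normrM (ger0_norm t0) (le_lt_trans _ b1)// ler_piMl.
have -> : x.2 - ((1 - t) * x.2 + t * y.2) = t * (x.2 - y.2) by ring.
by rewrite normrM (ger0_norm t0) (le_lt_trans _ b2)// ler_piMl.
Qed.

Lemma seg_connected_component (A : set point) x y z :
  connected_component A x y -> seg y z `<=` A ->
  seg y z `<=` connected_component A x.
Proof.
move=> xy yzA; rewrite (same_connected_component xy).
apply: connected_component_max => //; [exact: seg_left | exact: seg_connected].
Qed.

(** Balls are star-shaped about their centre, so a ball inside [A] is joined to its centre by
    segments in [A]. *)
Lemma connected_component_open (A : set point) x :
  open A -> open (connected_component A x).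
Proof.
rewrite !openE => oA y xy.
have /oA : A y by exact: connected_component_sub xy.
rewrite /interior -!nbhs_ballE => -[e /= e0 bA].
exists e => //= z yz.
apply: (seg_connected_component xy); last exact: seg_right.
by move=> w /(seg_sub_ball yz) /bA.
Qed.

(** The interiors of the two level sets of [W] are disjoint open sets covering [A], so each is
    relatively clopen in [A]. *)
Lemma connected_locally_constant (A : set point) (W : point -> bool) x y :
  connected A -> (forall z, A z -> \forall w \near z, W w = W z) ->
  A x -> A y -> W x = W y.
Proof.
move=> cA locW Ax Ay.
pose O b := [set z | W z = b]°.
have oO b : open (O b) by exact: open_interior.
have AO z : A z -> O (W z) z by move=> /locW.
suff AE : A `&` O (W y) = A.
  by move: Ax; rewrite -AE => -[_ /interior_subset].
apply: cA; first by exists y; split => //; exact: AO.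
  by exists (O (W y)).
exists (~` O (~~ W y)); first exact: open_closedC.
apply/seteqP; split=> z [Az Oz]; split=> //.
  by move=> /interior_subset /= Wz; move: Oz => /interior_subset /=; rewrite Wz; case: (W y).
have := AO _ Az; have [-> //|] := eqVneq (W z) (W y) => Wzy.
by have -> : W z = ~~ W y by case: (W z) (W y) Wzy => -[].
Qed.

End PlaneTopology.

(** * Crossing parity *)

Section SegmentTests.
Variable R : realType.
Local Notation point := (R * R)%type.
Implicit Types p q r s x y z : point.

Lemma segC p q : seg p q = seg q p.
Proof.
have sub a b : seg a b `<=` seg b a.
  move=> x [t [/andP[t0 t1] ->]]; exists (1 - t); split; first lra.
  by congr pair; ring.
by apply/seteqP; split; exact: sub.
Qed.

Lemma orientC p q z : orient q p z = - orient p q z.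
Proof. by rewrite /orient; ring. Qed.

Lemma orient_affine p q r s (t : R) :
  orient r s ((1 - t) * p.1 + t * q.1, (1 - t) * p.2 + t * q.2) =
  (1 - t) * orient r s p + t * orient r s q.
Proof. by rewrite /orient /=; ring. Qed.

Lemma orient_seg p q z : seg p q z -> orient p q z = 0.
Proof. by move=> [t [_ ->]]; rewrite /orient /=; ring. Qed.

Lemma orient_seg_gt0 r s p q z :
  0 < orient r s p * orient r s q -> seg p q z -> orient r s z != 0.
Proof.
move=> pq [t [/andP[t0 t1] ->]]; rewrite orient_affine.
move: (orient r s p) (orient r s q) pq => a b ab; apply/eqP => e.
have a0 : a != 0 by apply: contraTneq ab => ->; rewrite mul0r ltxx.
(* Multiplying the affine value by [a] makes both terms nonnegative, whatever the common sign of [a]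
   and [b]. *)
have : 0 < (1 - t) * a ^+ 2 + t * (a * b).
  have a2 : 0 < a ^+ 2 by rewrite exprn_even_gt0.
  have [->|t_neq1] := eqVneq t 1; first by rewrite subrr mul0r add0r mul1r.
  apply: ltr_pwDl; last by rewrite mulr_ge0 // ltW.
  by rewrite mulr_gt0 // subr_gt0 lt_neqAle t_neq1.
have -> : (1 - t) * a ^+ 2 + t * (a * b) = a * ((1 - t) * a + t * b) by ring.
by rewrite e mulr0 ltxx.
Qed.

Lemma seg_apartP p q r s : seg_apart p q r s -> seg p q `&` seg r s = set0.
Proof.
move=> pqrs; rewrite -subset0 => z [zpq zrs].
case/orP: pqrs => [/orient_seg_gt0|/orient_seg_gt0] H.
  by have := H _ zrs; rewrite orient_seg ?eqxx.
by have := H _ zpq; rewrite orient_seg ?eqxx.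
Qed.

Lemma seg_crossP p q r s :
  seg_cross p q r s -> exists2 x, seg p q x & seg r s x.
Proof.
move=> /andP[CD AB].
set A := orient r s p in AB; set B := orient r s q in AB.
set C := orient p q r in CD; set D := orient p q s in CD.
(* Both sides are the cross product of [q - p] and [s - r], so the parameters of the crossing point
   on the two segments share a denominator up to sign. *)
have DC : D - C = A - B by rewrite /A /B /C /D /orient; ring.
have d0 : A - B != 0 by apply/eqP => e; nra.
have tP (a b : R) : a * b < 0 -> a - b != 0 -> 0 <= a / (a - b) <= 1.
  move=> ab ab0; have -> : a / (a - b) = a * (a - b) / (a - b) ^+ 2 by field.
  have sq : 0 < (a - b) ^+ 2 by rewrite exprn_even_gt0.
  by rewrite divr_ge0 ?(ltW sq) ?ler_pdivrMr//; nra.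
have e0 : C - D != 0 by rewrite -oppr_eq0 opprB DC.
exists ((1 - A / (A - B)) * p.1 + A / (A - B) * q.1,
        (1 - A / (A - B)) * p.2 + A / (A - B) * q.2).
  by exists (A / (A - B)); split => //; exact: tP.
exists (C / (C - D)); split; first exact: tP.
have -> : C / (C - D) = - C / (A - B).
  by rewrite -DC -opprB invrN mulrN mulNr.
have E (a b c d : R) : (A - B) * (a - c) - (b - a) * - A + (d - c) * C = 0 ->
    (1 - A / (A - B)) * a + A / (A - B) * b =
    (1 - - C / (A - B)) * c + - C / (A - B) * d.
  move=> e; apply/eqP; rewrite -subr_eq0; apply/eqP.
  by rewrite -(mul0r (A - B)^-1) -e; field.
by congr pair; apply: E; rewrite /A /B /C /orient; ring.
Qed.

(** At parameter [t] on [seg q r] the orientation relative to [p q] is [t * orient p q r]; it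
    vanishes on the first segment, which forces [t = 0]. *)
Lemma seg_adjacent p q r :
  orient p q r != 0 -> seg p q `&` seg q r = [set q].
Proof.
move=> pqr; apply/seteqP; split => z /=; last first.
  by move=> ->; split; [exact: seg_right | exact: seg_left].
move=> [/orient_seg zpq [t [_ ze]]]; move: zpq; rewrite ze orient_affine.
have -> : orient p q q = 0 by rewrite /orient; ring.
rewrite mulr0 add0r => /eqP; rewrite mulf_eq0 (negPf pqr) orbF => /eqP ->.
by rewrite subr0 !mul1r !mul0r !addr0 -surjective_pairing.
Qed.

Lemma seg_of_orient p q y :
  p.1 < q.1 -> p.1 <= y.1 <= q.1 -> orient p q y = 0 -> seg p q y.
Proof.
move=> pq /andP[py yq] o; have d0 : q.1 - p.1 != 0 by rewrite subr_eq0 gt_eqF.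
exists ((y.1 - p.1) / (q.1 - p.1)); split.
  by rewrite divr_ge0 ?ler_pdivrMr ?subr_gt0 ?subr_ge0 ?(ltW pq)// mul1r lerB.
have E : y.2 = p.2 + (q.2 - p.2) * (y.1 - p.1) / (q.1 - p.1).
  apply: (mulIf d0); rewrite mulrDl divfK //.
  move: o; rewrite /orient => o; lra.
by rewrite [LHS]surjective_pairing; congr pair; [|rewrite E]; field.
Qed.

Lemma seg_vertical p q y :
  p.1 = q.1 -> y.1 = p.1 -> p.2 <= y.2 < q.2 -> seg p q y.
Proof.
move=> pq yp /andP[py yq].
have pq2 := le_lt_trans py yq.
have d0 : q.2 - p.2 != 0 by rewrite subr_eq0 gt_eqF.
exists ((y.2 - p.2) / (q.2 - p.2)); split.
  rewrite divr_ge0 ?ler_pdivrMr ?subr_gt0 ?subr_ge0 ?(ltW pq2)// mul1r.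
  by rewrite lerB // ltW.
by rewrite [LHS]surjective_pairing -pq yp; congr pair; field.
Qed.

Lemma ray_crossesC p q z : ray_crosses p q z = ray_crosses q p z.
Proof. by rewrite /ray_crosses orientC oppr_lt0 oppr_gt0 orbC. Qed.

Lemma continuous_orient p q : continuous (orient p q).
Proof.
move=> z; apply: cvgB; apply: cvgM; try exact: cvg_cst.
  by apply: cvgB; [exact: cvg_snd|exact: cvg_cst].
by apply: cvgB; [exact: cvg_fst|exact: cvg_cst].
Qed.

Lemma near_fst_lt y (a : R) : y.1 < a -> \forall z \near y, z.1 < a.
Proof. exact: (@cvgr_lt _ _ (nbhs y) _ fst y.1 cvg_fst). Qed.

Lemma near_fst_gt y (a : R) : a < y.1 -> \forall z \near y, a < z.1.
Proof. exact: (@cvgr_gt _ _ (nbhs y) _ fst y.1 cvg_fst). Qed.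

Lemma near_orient_sign p q y : orient p q y != 0 ->
  \forall z \near y, (orient p q z < 0) = (orient p q y < 0).
Proof.
rewrite neq_lt => /orP[ho|ho].
  have lt0 := @cvgr_lt _ _ _ _ _ _ (@continuous_orient p q y) _ ho.
  near=> z; rewrite ho; apply/idP; near: z; exact: lt0.
have gt0 := @cvgr_gt _ _ _ _ _ _ (@continuous_orient p q y) _ ho.
near=> z; rewrite !ltNge (ltW ho) ltW //; near: z; exact: gt0.
Unshelve. all: by end_near. Qed.

(** For [z] near [y] this jumps only if [p] is vertically above [y], as the upward ray from [z]
    sweeps past [p]. *)
Let above y p z := (p.1 <= z.1) && (y.2 < p.2).

(** Near [y] the crossing test changes only when [z.1] passes the abscissa of an end above [y], and
    the [above] term of that end jumps with it. Elsewhere [y] is off the segment, so the relevant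
    orientation keeps its sign. *)
Lemma ray_crosses_locally_constant p q y : ~ seg p q y ->
  exists b, \forall z \near y,
    ray_crosses p q z (+) above y p z (+) above y q z = b.
Proof.
wlog pq : p q / p.1 <= q.1 => [hw|] npq.
  have [/hw|/ltW /hw] := leP p.1 q.1; first exact.
  rewrite segC => /(_ npq)[b qpb]; exists b; near=> z.
  by rewrite ray_crossesC addbAC; near: z.
have oyp : p.1 = y.1 -> orient p q y = (q.1 - p.1) * (y.2 - p.2).
  by rewrite /orient => <-; ring.
have oyq : q.1 = y.1 -> orient p q y = (q.1 - p.1) * (y.2 - q.2).
  by rewrite /orient => <-; ring.
rewrite /above; move: pq; rewrite le_eqVlt => /orP[/eqP pq|pq].
  have rc z : ray_crosses p q z = false.
    by apply/negbTE/negP => /orP[] /andP[/andP[]]; rewrite pq => /le_lt_trans/[apply]; rewrite ltxx.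
  have [yp|yp|yp] := ltgtP y.1 p.1.
  - exists false; near=> z; have zp : z.1 < p.1 by near: z; exact: near_fst_lt.
    by rewrite rc -pq leNgt zp.
  - exists ((y.2 < p.2) (+) (y.2 < q.2)); near=> z.
    have zp : p.1 < z.1 by near: z; exact: near_fst_gt.
    by rewrite rc -pq (ltW zp).
  (* On the line of a vertical segment, either both ends are above [y] or neither is, since
     otherwise [y] would lie on the segment; the two corrections cancel. *)
  exists false; near=> z; rewrite rc -pq.
  case: ltP => yp2; case: ltP => yq2; rewrite ?andbF ?andbT ?addbb //.
    by exfalso; apply: npq; rewrite segC; apply: seg_vertical; rewrite -?pq ?yq2.
  by exfalso; apply: npq; apply: seg_vertical; rewrite // yp2.
have rcE z : p.1 < z.1 -> ray_crosses p q z = (z.1 < q.1) && (orient p q z < 0).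
  by move=> pz; rewrite /ray_crosses (ltW pz) (ltNge z.1 p.1) (ltW pz) !andbF orbF.
have rcE' z : z.1 < q.1 -> ray_crosses p q z = (p.1 <= z.1) && (orient p q z < 0).
  by move=> zq; rewrite /ray_crosses zq andbT (leNgt q.1) zq orbF.
have [yp|yp|yp] := ltgtP y.1 p.1.
- exists false; near=> z; have zp : z.1 < p.1 by near: z; exact: near_fst_lt.
  by rewrite rcE' ?(lt_trans zp)// !leNgt zp (lt_trans zp).
- have [yq|yq|yq] := ltgtP y.1 q.1.
  + have o : orient p q y != 0.
      apply/eqP => /(seg_of_orient pq) s; apply/npq/s.
      by rewrite (ltW yp) (ltW yq).
    exists ((orient p q y < 0) (+) (y.2 < p.2)); near=> z.
    have zq : z.1 < q.1 by near: z; exact: near_fst_lt.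
    have pz : p.1 < z.1 by near: z; exact: near_fst_gt.
    rewrite rcE // zq (ltW pz) leNgt zq addbF /=; congr (_ (+) _).
    by near: z; exact: near_orient_sign.
  + exists ((y.2 < p.2) (+) (y.2 < q.2)); near=> z.
    have qz : q.1 < z.1 by near: z; exact: near_fst_gt.
    have pz := lt_trans pq qz.
    by rewrite rcE // ltNge (ltW qz) (ltW pz).
  + have yq2 : y.2 != q.2.
      apply/eqP => yq2; apply: npq.
      by rewrite [y]surjective_pairing yq yq2 -surjective_pairing; exact: seg_right.
    have o : orient p q y != 0 by rewrite oyq // mulf_neq0 // subr_eq0 // gt_eqF.
    have oE : (orient p q y < 0) = (y.2 < q.2).
      by rewrite oyq // pmulr_rlt0 ?subr_gt0// subr_lt0.
    exists ((y.2 < p.2) (+) (y.2 < q.2)); near=> z.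
    have pz : p.1 < z.1 by near: z; exact: near_fst_gt.
    have -> : ray_crosses p q z = (z.1 < q.1) && (y.2 < q.2).
      by rewrite rcE // -oE; congr andb; near: z; exact: near_orient_sign.
    by rewrite (ltW pz) /=; case: (ltP z.1); case: (y.2 < p.2); case: (y.2 < q.2).
have yp2 : y.2 != p.2.
  apply/eqP => yp2; apply: npq.
  by rewrite [y]surjective_pairing yp yp2 -surjective_pairing; exact: seg_left.
have o : orient p q y != 0 by rewrite oyp // mulf_neq0 // subr_eq0 // gt_eqF.
have oE : (orient p q y < 0) = (y.2 < p.2).
  by rewrite oyp // pmulr_rlt0 ?subr_gt0// subr_lt0.
exists false; near=> z.
have zq : z.1 < q.1 by near: z; apply: near_fst_lt; rewrite yp.
have -> : ray_crosses p q z = (p.1 <= z.1) && (y.2 < p.2).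
  by rewrite rcE' // -oE; congr andb; near: z; exact: near_orient_sign.
by rewrite addbb (leNgt q.1) zq.
Unshelve. all: by end_near. Qed.

(* Near [y] the ray through a vertex above [y] enters and leaves by the two
   incident edges together, so the [above] corrections telescope away. *)
Lemma ray_parity_locally_constant (v : nat -> point) n y :
  v n = v 0%N -> ~ chain_set n (fun i => seg (v i) (v i.+1)) y ->
  \forall z \near y, ray_parity v n z = ray_parity v n y.
Proof.
move=> vn ny.
suff [b] : exists b, \forall z \near y,
    ray_parity v n z (+) above y (v 0%N) z (+) above y (v n) z = b.
  rewrite vn => bP; have yb := nbhs_singleton bP.
  near=> z; have zb : ray_parity v n z (+) above y (v 0) z (+) above y (v 0) z = b.
    by near: z.
  by rewrite -(addbK (above y (v 0%N) z) (ray_parity v n z)) zb -yb addbK.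
elim: n {vn} ny => [|n IH] ny.
  by exists false; near=> z; rewrite /= addbb.
have [|b bP] := IH; first by move=> [i [im yi]]; apply: ny; exists i; split => //; exact: ltnW.
have [|c cP] := @ray_crosses_locally_constant (v n) (v n.+1) y.
  by move=> yi; apply: ny; exists n.
exists (b (+) c); near=> z => /=.
have <- : ray_parity v n z (+) above y (v 0) z (+) above y (v n) z = b by near: z.
have <- : ray_crosses (v n) (v n.+1) z (+) above y (v n) z (+) above y (v n.+1) z = c.
  by near: z.
case: ray_crosses; case: ray_parity; case: (above y (v 0%N) z);
  by case: (above y (v n) z); case: (above y (v n.+1) z).
Unshelve. all: by end_near. Qed.

Lemma ray_parity_connected (A : set point) (v : nat -> point) n x y :
  v n = v 0%N -> connected A ->
  A `<=` ~` chain_set n (fun i => seg (v i) (v i.+1)) ->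
  A x -> A y -> ray_parity v n x = ray_parity v n y.
Proof.
move=> vn cA Av; apply: connected_locally_constant cA _ => z Az.
by apply: ray_parity_locally_constant => //; exact: Av.
Qed.

(** Below all the vertices an edge is crossed exactly when [z.1] separates its ends, and these
    indicators telescope; for a closed line nothing remains. *)
Lemma ray_parity_low (v : nat -> point) n z :
  (forall i, (i <= n)%N -> z.2 < (v i).2) ->
  ray_parity v n z = ((v 0%N).1 <= z.1) (+) ((v n).1 <= z.1).
Proof.
elim: n => [|n IH] zv /=; first by rewrite addbb.
rewrite IH => [|i iN]; last by apply: zv; exact: leqW.
have zn := zv n (leqnSn n); have zn1 := zv n.+1 (leqnn _).
have low p q : z.2 < p.2 -> z.2 < q.2 -> p.1 <= z.1 -> z.1 < q.1 ->
    orient p q z < 0.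
  by rewrite /orient => *; nra.
have -> : ray_crosses (v n) (v n.+1) z =
    ((v n).1 <= z.1) (+) ((v n.+1).1 <= z.1).
  rewrite /ray_crosses.
  case: (leP (v n).1 z.1) => a; case: (leP (v n.+1).1 z.1) => b //=.
    by rewrite low.
  by rewrite orientC oppr_gt0 low.
by rewrite addbC addbA addbK.
Qed.

Lemma ray_parity_high (v : nat -> point) n z :
  (forall i, (i <= n)%N -> (v i).2 < z.2) -> ray_parity v n z = false.
Proof.
elim: n => [|n IH] zv //=.
rewrite IH => [|i iN]; last by apply: zv; exact: leqW.
have zn := zv n (leqnSn n); have zn1 := zv n.+1 (leqnn _).
rewrite addbF; apply/negbTE/negP; rewrite /ray_crosses /orient.
by case/orP => /andP[/andP[a b] c]; nra.
Qed.

Lemma ray_parity_side (v : nat -> point) n z :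
  (forall i, (i <= n)%N -> (v i).1 <= z.1) \/
  (forall i, (i <= n)%N -> z.1 < (v i).1) -> ray_parity v n z = false.
Proof.
elim: n => [|n IH] zv //=.
rewrite IH; last by case: zv => zv; [left|right] => i iN; apply: zv; exact: leqW.
rewrite addbF; apply/negbTE/negP; rewrite /ray_crosses.
case: zv => zv; have zn := zv n (leqnSn n); have zn1 := zv n.+1 (leqnn _);
  by case/orP => /andP[/andP[a b] c]; lra.
Qed.

Lemma ray_parity_bounded (v : nat -> point) n :
  v n = v 0%N -> bounded_set2 [set z | ray_parity v n z].
Proof.
move=> vn.
(* A crude bound on all coordinates of the vertices. Outside the box of half-width [M] the ray meets
   no edge or, from below, an even number of them. *)
pose M : R := \sum_(i < n.+1) (`|(v i).1| + `|(v i).2|).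
have vM i : (i <= n)%N -> `|(v i).1| <= M /\ `|(v i).2| <= M.
  move=> iN; have iN' : (i < n.+1)%N by [].
  have : `|(v i).1| + `|(v i).2| <= M.
    by rewrite /M (bigD1 (Ordinal iN')) //= lerDl sumr_ge0 //.
  by move=> vM; split; apply: le_trans vM; rewrite ?lerDl ?lerDr.
exists M => z /= zv; split; rewrite leNgt; apply/negP => Mz; move: zv.
  rewrite ray_parity_side //; have [z0|z0] := leP 0 z.1.
    left => i /vM[+ _]; move: Mz; rewrite (ger0_norm z0) ler_norml => Mz /andP[_ vi].
    exact: ltW (le_lt_trans vi Mz).
  right => i /vM[+ _]; move: Mz; rewrite (ltr0_norm z0) ler_norml => Mz /andP[vi _].
  by lra.
have [z0|z0] := leP 0 z.2.
  rewrite ray_parity_high // => i /vM[_]; move: Mz.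
  by rewrite (ger0_norm z0) ler_norml => Mz /andP[_ vi]; lra.
rewrite ray_parity_low ?vn ?addbb // => i /vM[_]; move: Mz.
by rewrite (ltr0_norm z0) ler_norml => Mz /andP[vi _]; lra.
Qed.

End SegmentTests.

(** * Inside representations of K_{2,3} *)

Section K23Inside.
Variable R : realType.
Local Notation point := (R * R)%type.
Implicit Types p q r s x y z : point.

Lemma segxx x z : seg x x z -> z = x.
Proof.
move=> [t [_ ->]]; rewrite [RHS]surjective_pairing.
by congr pair; ring.
Qed.

Lemma unbounded_ray (D : set point) c d : d != (0, 0) ->
  (forall t : R, 0 <= t -> ~ D (c.1 + t * d.1, c.2 + t * d.2)) ->
  ~ bounded_set2 (connected_component (~` D) c).
Proof.
move=> d0 nD [M MP].
have cM (t : R) : 0 <= t ->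
    connected_component (~` D) c (c.1 + t * d.1, c.2 + t * d.2).
  move=> t0; apply: (@seg_connected_component _ _ _ c); last exact: seg_right.
    apply: connected_component_refl; have := nD 0 (lexx 0).
    by rewrite !mul0r !addr0 -surjective_pairing.
  move=> z [s [/andP[s0 s1] ->]] /=.
  have -> : (1 - s) * c.1 + s * (c.1 + t * d.1) = c.1 + (s * t) * d.1 by ring.
  have -> : (1 - s) * c.2 + s * (c.2 + t * d.2) = c.2 + (s * t) * d.2 by ring.
  exact/nD/mulr_ge0.
have M0 : 0 <= M by have [+ _] := MP _ (cM 0 (lexx 0)); exact: le_trans.
have big (a b : R) : b != 0 ->
    (forall t, 0 <= t -> `|a + t * b| <= M) -> False.
  move=> b0 H; have b0' : 0 < `|b| by rewrite normr_gt0.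
  (* At this parameter the moving term has absolute value [M + |a| + 1], so the sum with [a] exceeds
     [M] in absolute value. *)
  have t0 : 0 <= (M + `|a| + 1) / `|b| by rewrite divr_ge0 ?addr_ge0.
  have := H _ t0; apply/negP; rewrite -ltNge.
  have : `|(M + `|a| + 1) / `|b| * b| = M + `|a| + 1.
    by rewrite normrM normf_div normr_id divfK ?gt_eqF// ger0_norm ?addr_ge0.
  move: ((_ / _ * b)) => u uE.
  have : `|u| <= `|a + u| + `|a|.
    by rewrite -{1}(addKr a u) addrC; apply: le_trans (ler_normD _ _) _; rewrite normrN.
  by rewrite uE; lra.
have [d1|d1] := eqVneq d.1 0.
  have d2 : d.2 != 0.
    apply: contra d0 => /eqP d2.
    by rewrite [d]surjective_pairing d1 d2.
  by apply: (big c.2 d.2 d2) => t t0; have [] := MP _ (cM t t0).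
by apply: (big c.1 d.1 d1) => t t0; have [] := MP _ (cM t t0).
Qed.

Lemma obstacle_rep_drawing (V : finType) (adj : rel V) f (C : set point) :
  obstacle_rep adj f C -> C `<=` ~` drawing adj f.
Proof.
move=> [_ _ fC eC] z Cz [u [v [uv zuv]]].
have [e|nuv] := eqVneq u v.
  by move: zuv; rewrite e => /segxx zv; apply: (fC v); rewrite -zv.
move: uv; rewrite (negPf nuv) /= => /(eC _ _ nuv) e.
suff : set0 z by []; by rewrite -e.
Qed.

Lemma drawing_half_plane (V : finType) (adj : rel V) (f : V -> point) p q z :
  (forall u, 0 <= orient p q (f u)) -> drawing adj f z -> 0 <= orient p q z.
Proof.
move=> fp [u [v [_ [t [/andP[t0 t1] ->]]]]]; rewrite orient_affine.
by rewrite addr_ge0 // mulr_ge0 // subr_ge0.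
Qed.

Lemma hull_edge_unbounded (V : finType) (adj : rel V) (f : V -> point) p q c :
  p != q -> (forall u, 0 <= orient p q (f u)) -> seg p q c ->
  ~ drawing adj f c -> in_unbounded_face adj f c.
Proof.
move=> pq fp pqc nc; split=> //.
(* The normal of [p q] pointing away from the drawing: moving by [t] along it lowers [orient p q] by
   [t] times the squared length of [p q]. *)
apply: (@unbounded_ray _ _ (q.2 - p.2, p.1 - q.1)).
  apply: contra pq; rewrite xpair_eqE !subr_eq0 => /andP[/eqP e2 /eqP e1].
  by rewrite [p]surjective_pairing [q]surjective_pairing e1 e2.
move=> t; rewrite le_eqVlt => /orP[/eqP <-|t0].
  by rewrite !mul0r !addr0 -surjective_pairing.
move=> /(drawing_half_plane fp) /=.
have -> : orient p q (c.1 + t * (q.2 - p.2), c.2 + t * (p.1 - q.1)) =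
    orient p q c - t * ((q.1 - p.1) ^+ 2 + (q.2 - p.2) ^+ 2).
  by rewrite /orient /=; ring.
rewrite (orient_seg pqc) sub0r oppr_ge0 => H.
have : 0 < (q.1 - p.1) ^+ 2 + (q.2 - p.2) ^+ 2.
  rewrite lt_neqAle addr_ge0 ?sqr_ge0 // andbT eq_sym paddr_eq0 ?sqr_ge0 //.
  rewrite !sqrf_eq0 !subr_eq0; apply: contra pq => /andP[/eqP e1 /eqP e2].
  by rewrite [p]surjective_pairing [q]surjective_pairing e1 e2.
by move=> d0; move: H; rewrite leNgt mulr_gt0.
Qed.

(** Divided by [orient a b p], the three orientations are the barycentric coordinates of [z]; the
    one attached to [b] vanishes and the other two are nonnegative. *)
Lemma seg_barycentric a b p z :
  0 < orient a b p -> orient p a z = 0 ->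
  0 <= orient a b z -> 0 <= orient b p z -> seg a p z.
Proof.
move=> D0 l1 h l2; have dN : orient a b p != 0 by rewrite gt_eqF.
have sumE : orient a b z + orient b p z = orient a b p.
  by rewrite -[LHS]addr0 -l1 /orient; ring.
exists (orient a b z / orient a b p); split.
  by rewrite divr_ge0 ?(ltW D0)// ler_pdivrMr // mul1r -sumE lerDl.
have E (u v w : R) : u * orient a b p =
    orient b p z * v + orient a b z * w ->
    u = (1 - orient a b z / orient a b p) * v + orient a b z / orient a b p * w.
  move=> e; apply: (mulIf dN); rewrite e; move: dN; rewrite -sumE => dN.
  by field.
rewrite [LHS]surjective_pairing; congr pair; apply: E.
  have -> : z.1 * orient a b p = orient b p z * a.1 + orient p a z * b.1 +
    orient a b z * p.1 by rewrite /orient; ring.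
  by rewrite l1; ring.
have -> : z.2 * orient a b p = orient b p z * a.2 + orient p a z * b.2 +
    orient a b z * p.2 by rewrite /orient; ring.
by rewrite l1; ring.
Qed.

Lemma connected_two_open (A U V : set point) x y :
  connected A -> open U -> open V -> A `<=` U `|` V -> U `&` V = set0 ->
  A x -> A y -> U x -> U y.
Proof.
move=> cA oU oV AUV UV Ax Ay Ux.
suff AE : A `&` U = A by move: Ay; rewrite -AE => -[].
apply: cA; first by exists x.
  by exists U.
exists (~` V); first exact: open_closedC.
apply/seteqP; split=> z [Az Uz]; split => //.
  by move=> Vz; have : (U `&` V) z by []; rewrite UV.
by case: (AUV _ Az).
Qed.

Lemma open_orient_gt0 p q : open [set z | 0 < orient p q z].
Proof.
apply: (@open_comp _ _ (orient p q) [set t | 0 < t]) => [z _|].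
  exact: continuous_orient.
exact: open_gt.
Qed.

Lemma open_orient_lt0 p q : open [set z | orient p q z < 0].
Proof.
apply: (@open_comp _ _ (orient p q) [set t | t < 0]) => [z _|].
  exact: continuous_orient.
exact: open_lt.
Qed.

(* [y] is at least as far from the line [a b] as [p] is, hence outside the
   quadrilateral [a q b p] whose diagonal [a b] contains [c]. *)
Lemma quadrilateral_separates (A : set point) a b p q c y :
  0 < orient a b p -> orient a b q < 0 -> connected A ->
  A `&` seg a p = set0 -> A `&` seg b p = set0 ->
  A `&` seg a q = set0 -> A `&` seg b q = set0 ->
  seg a b c -> c != a -> c != b -> A c -> A y ->
  orient a b p <= orient a b y -> False.
Proof.
move=> Dp Dq cA ap bp aq bq [t [/andP[t0 t1] cE]] ca cb Ac Ay py.
have t0' : 0 < t.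
  rewrite lt_neqAle t0 andbT; apply: contra ca => /eqP te.
  by rewrite cE -te subr0 !mul1r !mul0r !addr0 -surjective_pairing.
have t1' : t < 1.
  rewrite lt_neqAle t1 andbT; apply: contra cb => /eqP te.
  by rewrite cE te subrr !mul1r !mul0r !add0r -surjective_pairing.
have Dq' : 0 < orient b a q by rewrite orientC oppr_gt0.
(* Unnormalised barycentric coordinates for the triangle [a b p]; [l3] and [l4] play the roles of
   [l1] and [l2] for the triangle [a b q]. *)
pose h z := orient a b z; pose l1 z := orient p a z; pose l2 z := orient b p z.
pose l3 z := orient a q z; pose l4 z := orient q b z.
have hl z : h z + l1 z + l2 z = orient a b p by rewrite /h /l1 /l2 /orient; ring.
(* On the line [a b] both [l1] and [l3] are affine and vanish at [a], hence they are proportional;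
   likewise [l2] and [l4] at [b]. *)
have l13 z : h z = 0 -> l1 z * orient b a q = l3 z * orient a b p.
  move=> hz; apply/eqP; rewrite -subr_eq0; apply/eqP.
  have -> : l1 z * orient b a q - l3 z * orient a b p = - orient a q p * h z.
    by rewrite /h /l1 /l3 /orient; ring.
  by rewrite hz mulr0.
have l24 z : h z = 0 -> l2 z * orient b a q = l4 z * orient a b p.
  move=> hz; apply/eqP; rewrite -subr_eq0; apply/eqP.
  have -> : l2 z * orient b a q - l4 z * orient a b p = - orient q b p * h z.
    by rewrite /h /l2 /l4 /orient; ring.
  by rewrite hz mulr0.
pose P p q := [set z | 0 < orient p q z]; pose N p q := [set z | orient p q z < 0].
(* [U] consists of the two open triangles and an open set containing the open diagonal. [W] covers
   the outside, its last piece taking care of the line [a b] beyond [a] and beyond [b]. *)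
pose U := (P a b `&` P p a `&` P b p) `|` (N a b `&` P a q `&` P q b) `|`
          (P p a `&` P b p `&` P a q `&` P q b).
pose W := (P a b `&` (N p a `|` N b p)) `|` (N a b `&` (N a q `|` N q b)) `|`
          ((N p a `&` N a q) `|` (N b p `&` N q b)).
have oP r s : open (P r s) by exact: open_orient_gt0.
have oN r s : open (N r s) by exact: open_orient_lt0.
have oU : open U by rewrite /U; do ![apply: openU | apply: openI].
have oW : open W by rewrite /W; do ![apply: openU | apply: openI].
have UW : U `&` W = set0.
  rewrite -subset0 => z [] /=; rewrite /U /W /P /N /= => Uz Wz.
  by move: Uz Wz; clear; intuition; lra.
have AUW : A `<=` U `|` W.
  move=> z Az.
  have nseg r s : A `&` seg r s = set0 -> ~ seg r s z.
    by move=> E zrs; have : (A `&` seg r s) z by []; rewrite E.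
  have {}ap := nseg _ _ ap; have {}bp := nseg _ _ bp.
  have {}aq := nseg _ _ aq; have {}bq := nseg _ _ bq.
  have sap : l1 z = 0 -> 0 <= h z -> 0 <= l2 z -> False.
    by move=> e1 e2 e3; apply/ap/(@seg_barycentric a b).
  have sbp : l2 z = 0 -> 0 <= h z -> 0 <= l1 z -> False.
    move=> e1 e2 e3; apply: bp; rewrite segC.
    apply: (@seg_barycentric p a) => //.
    by have -> : orient p a b = orient a b p by rewrite /orient; ring.
  have hN : orient b a z = - h z by rewrite orientC.
  have saq : l3 z = 0 -> h z <= 0 -> 0 <= l4 z -> False.
    move=> e1 e2 e3; apply: aq; rewrite segC; apply: (@seg_barycentric q b) => //.
    - by have -> : orient q b a = orient b a q by rewrite /orient; ring.
    - by rewrite hN oppr_ge0.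
  have sbq : l4 z = 0 -> h z <= 0 -> 0 <= l3 z -> False.
    by move=> e1 e2 e3; apply/bq/(@seg_barycentric b a) => //; rewrite hN oppr_ge0.
  rewrite /U /W /P /N /=; rewrite -/(h z) -/(l1 z) -/(l2 z) -/(l3 z) -/(l4 z).
  have sgn3 (u : R) : u < 0 \/ 0 < u \/ u = 0.
    by have [] := ltgtP u 0; [left | right; left | right; right].
  have [h0|[h0|h0]] := sgn3 (h z).
  - have [e3|[e3|e3]] := sgn3 (l3 z); [tauto| |].
      have [e4|[e4|e4]] := sgn3 (l4 z); [tauto|tauto|].
      by exfalso; apply: sbq => //; exact: ltW.
    have [e4|[/ltW e4|e4]] := sgn3 (l4 z); [tauto| |].
    by exfalso; apply: saq => //; exact: ltW.
    by exfalso; apply: saq; rewrite ?e4 //; exact: ltW.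
  - have [e3|[e3|e3]] := sgn3 (l1 z); [tauto| |].
      have [e4|[e4|e4]] := sgn3 (l2 z); [tauto|tauto|].
      by exfalso; apply: sbp => //; exact: ltW.
    have [e4|[/ltW e4|e4]] := sgn3 (l2 z); [tauto| |].
    by exfalso; apply: sap => //; exact: ltW.
    by exfalso; apply: sap; rewrite ?e4 //; exact: ltW.
  (* On the line [a b] the signs of [l1] and [l3] agree, and so do those of [l2] and [l4], which
     puts [z] in the last piece of [U] or of [W]. *)
  have e13 := l13 _ h0; have e24 := l24 _ h0; have hs := hl z; rewrite h0 in hs.
  have sg (u v d e : R) : 0 < d -> 0 < e -> u * d = v * e ->
      (0 < u -> 0 < v) /\ (u < 0 -> v < 0).
    move=> d0 e0 E; split => u0.
      by rewrite -(pmulr_lgt0 _ e0) -E mulr_gt0.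
    by rewrite -(pmulr_llt0 _ e0) -E pmulr_llt0.
  have [p13 n13] := sg _ _ _ _ Dq' Dp e13; have [p24 n24] := sg _ _ _ _ Dq' Dp e24.
  have [e1|[e1|e1]] := sgn3 (l1 z); [tauto| |].
    have [e2|[e2|e2]] := sgn3 (l2 z); [tauto|tauto|].
    by exfalso; apply: sbp; rewrite ?h0 //; exact: ltW.
  exfalso; apply: sap; rewrite ?h0 //; move: hs; rewrite e1 => hs; lra.
have Uc : U c.
  right; rewrite /P /=.
  have Q u : 0 < u -> 0 < 1 - t -> 0 < (1 - t) * u by move=> *; exact: mulr_gt0.
  have s1 : 0 < 1 - t by lra.
  have Z1 r s : orient r s r = 0 by rewrite /orient; ring.
  have Z2 r s : orient r s s = 0 by rewrite /orient; ring.
  have c1 : orient p a b = orient a b p by rewrite /orient; ring.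
  have c2 : orient b p a = orient a b p by rewrite /orient; ring.
  have c3 : orient a q b = orient b a q by rewrite /orient; ring.
  have c4 : orient q b a = orient b a q by rewrite /orient; ring.
  rewrite cE !orient_affine !Z1 !Z2 c1 c2 c3 c4 !mulr0 !add0r !addr0.
  by do !split; rewrite mulr_gt0.
(* In [U] either [h] is negative, or [l1] and [l2] are positive and [hl] gives [h y < orient a b p];
   both contradict the height of [y]. *)
have := connected_two_open cA oU oW AUW UW Ac Ay Uc.
rewrite /U /P /N /= => -[[[[]]|[[]]]|[[[]]]]; have := hl y; rewrite /h /l1 /l2 => *; lra.
Qed.

Lemma not_empty_inter (A B : set point) :
  A `&` B <> set0 -> exists2 z, A z & B z.
Proof. by move=> /eqP/set0P[z [Az Bz]]; exists z. Qed.

Lemma obstacle_connected (C : set point) : obstacle C -> connected C.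
Proof. by move=> [_ [B [_ [x [_ ->]]]]]; exact: component_connected. Qed.

Lemma K23_no_inside_obstacle_rep : ~ has_inside_obstacle_rep R K23.
Proof.
move=> [f [C [repC inC]]].
have CD := obstacle_rep_drawing repC.
have [obC [injf gp] fC eC] := repC.
have cC := obstacle_connected obC.
have edge (u v : 'I_5) : (u < 2)%N -> (2 <= v)%N -> C `&` seg (f u) (f v) = set0.
  move=> u2 v2; have uv : u != v.
    by apply: contraTneq u2 => ->; rewrite -leqNgt.
  by rewrite setIC; apply/(eC _ _ uv); rewrite /K23 u2 ltnNge v2.
have nonedge (u v : 'I_5) : u != v -> (u < 2)%N = (v < 2)%N ->
    exists2 z, seg (f u) (f v) z & C z.
  by move=> uv e; apply/not_empty_inter => /(eC _ _ uv); rewrite /K23 e eqxx.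
have nf z (u : 'I_5) : C z -> z != f u by move=> Cz; apply/eqP => zu; apply: (fC u); rewrite -zu.
have two_one (a b p q r : 'I_5) : (a < 2)%N -> (b < 2)%N -> a != b ->
    (2 <= p)%N -> (2 <= q)%N -> (2 <= r)%N -> p != r ->
    0 < orient (f a) (f b) (f p) -> 0 < orient (f a) (f b) (f r) ->
    orient (f a) (f b) (f q) < 0 -> False.
  wlog pr : p r / orient (f a) (f b) (f p) <= orient (f a) (f b) (f r).
    move=> hw a2 b2 ab p2 q2 r2 pr hp hr hq.
    have [?|/ltW ?] := leP (orient (f a) (f b) (f p)) (orient (f a) (f b) (f r)).
      exact: (hw p r).
    by apply: (hw r p) => //; rewrite eq_sym.
  move=> a2 b2 ab p2 q2 r2 p_r hp hr hq.
  have [c cab Cc] := nonedge a b ab (etrans a2 (esym b2)).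
  have [y [t [/andP[t0 t1] yE]] Cy] : exists2 z, seg (f p) (f r) z & C z.
    by apply: nonedge; rewrite // (ltnNge p) p2 (ltnNge r) r2.
  apply: (quadrilateral_separates hp hq cC _ _ _ _ cab _ _ Cc Cy); try exact: edge;
    try exact: nf.
  (* The height over the line [a b] is affine along the segment, so [y] is at least as high as the
     lower end [p]. *)
  rewrite yE orient_affine.
  have -> : (1 - t) * orient (f a) (f b) (f p) + t * orient (f a) (f b) (f r) =
    orient (f a) (f b) (f p) +
      t * (orient (f a) (f b) (f r) - orient (f a) (f b) (f p)) by ring.
  by rewrite lerDl mulr_ge0 // subr_ge0.
have one_side (a b : 'I_5) : (a < 2)%N -> (b < 2)%N -> a != b ->
    (forall u : 'I_5, (2 <= u)%N -> 0 < orient (f a) (f b) (f u)) -> False.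
  move=> a2 b2 ab H; have [c cab Cc] := nonedge a b ab (etrans a2 (esym b2)).
  (* The line [a b] supports the drawing, so the obstacle point [c] on it lies in the unbounded
     face. *)
  apply: (inC _ Cc); apply: (hull_edge_unbounded _ _ cab); last exact: CD.
    by apply: contra ab => /eqP/injf ->.
  move=> u; have [u2|/H/ltW //] := ltnP u 2.
  suff [->|->] : u = a \/ u = b.
  - by rewrite le_eqVlt; apply/orP; left; apply/eqP; rewrite /orient; ring.
  - by rewrite le_eqVlt; apply/orP; left; apply/eqP; rewrite /orient; ring.
  case: a b u ab a2 b2 u2 {H c cab Cc} => [[|[|a]] ?] [[|[|b]] ?] [[|[|u]] ?] //= *;
    by [left; exact: val_inj | right; exact: val_inj].
pose o k : 'I_5 := inord k.
have oE k : (k < 5)%N -> nat_of_ord (o k) = k by move=> k5; rewrite inordK.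
pose h k := orient (f (o 0%N)) (f (o 1%N)) (f (o k)).
have onK i j : (i < 5)%N -> (j < 5)%N -> i != j -> o i != o j.
  by move=> i5 j5; apply: contra => /eqP/(congr1 val); rewrite /= !oE // => ->.
have hN k : h k = - orient (f (o 1%N)) (f (o 0%N)) (f (o k)) by rewrite /h orientC.
have h0 k : (2 <= k < 5)%N -> h k != 0.
  move=> /andP[k2 k5]; apply/eqP; apply: gp; apply: onK => //.
    by case: k k2 k5 => [|[]].
  by case: k k2 k5.
have ordk (u : 'I_5) : u = o u by apply: val_inj; rewrite /= oE.
have pos (a b : nat) : (a < 2)%N -> (b < 2)%N -> a != b ->
    0 < orient (f (o a)) (f (o b)) (f (o 2%N)) ->
    0 < orient (f (o a)) (f (o b)) (f (o 3%N)) ->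
    0 < orient (f (o a)) (f (o b)) (f (o 4%N)) -> False.
  move=> a2 b2 ab p2 p3 p4; apply: (one_side (o a) (o b)).
  - by rewrite oE // (leq_trans a2).
  - by rewrite oE // (leq_trans b2).
  - by apply: onK; rewrite // ?(leq_trans a2) ?(leq_trans b2).
  by move=> u; rewrite (ordk u) oE ?ltn_ord//; case: u => [[|[|[|[|[|]]]]] ?].
have mixed (a b p q r : nat) : (a < 2)%N -> (b < 2)%N -> a != b ->
    (2 <= p < 5)%N -> (2 <= q < 5)%N -> (2 <= r < 5)%N -> p != r ->
    0 < orient (f (o a)) (f (o b)) (f (o p)) ->
    0 < orient (f (o a)) (f (o b)) (f (o r)) ->
    orient (f (o a)) (f (o b)) (f (o q)) < 0 -> False.
  move=> a2 b2 ab /andP[p2 p5] /andP[q2 q5] /andP[r2 r5] pr.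
  apply: (two_one (o a) (o b) (o p) (o q) (o r));
    rewrite ?oE ?(leq_trans a2) ?(leq_trans b2) //; apply: onK => //;
    by [rewrite (leq_trans a2) | rewrite (leq_trans b2)].
have sgn k : (2 <= k < 5)%N -> (0 < h k /\ orient (f (o 1%N)) (f (o 0%N)) (f (o k)) < 0)
    \/ (h k < 0 /\ 0 < orient (f (o 1%N)) (f (o 0%N)) (f (o k))).
  move=> /h0; rewrite neq_lt hN oppr_lt0 oppr_gt0 => /orP[|]; tauto.
(* Eight sign patterns. Exchanging vertices 0 and 1 reverses all signs, so the majority can always
   be taken on the positive side. *)
case: (sgn 2%N isT) => -[h2 g2]; case: (sgn 3%N isT) => -[h3 g3];
  case: (sgn 4%N isT) => -[h4 g4].
- exact: (pos 0%N 1%N).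
- exact: (mixed 0%N 1%N 2%N 4%N 3%N).
- exact: (mixed 0%N 1%N 2%N 3%N 4%N).
- exact: (mixed 1%N 0%N 3%N 2%N 4%N).
- exact: (mixed 0%N 1%N 3%N 2%N 4%N).
- exact: (mixed 1%N 0%N 2%N 3%N 4%N).
- exact: (mixed 1%N 0%N 2%N 4%N 3%N).
- exact: (pos 1%N 0%N).
Qed.

End K23Inside.

(** * Integer certificates *)

Definition edge_adj (E : seq (nat * nat)) (i j : nat) : bool :=
  ((i, j) \in E) || ((j, i) \in E).

(** Indices wrap around as in [simple_polygon], so the last edge closes the curve. *)
Definition cyc_nth (T : Type) (x0 : T) (s : seq T) (i : nat) : T :=
  nth x0 s (i %% size s).

(* [cert_ways] are points joined to [cert_base] by segments inside the obstacle
   bounded by [cert_poly]; each non-edge has to cross one of these segments. *)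
Record certificate := Certificate {
  cert_edges : seq (nat * nat);
  cert_pts : seq (Z * Z);
  cert_poly : seq (Z * Z);
  cert_base : Z * Z;
  cert_ways : seq (Z * Z) }.

Section Checks.
Variable c : certificate.

Let pt i := nth (0, 0) (cert_pts c) i.
Let n := size (cert_poly c).
Let v := cyc_nth (0, 0) (cert_poly c).

Definition seg_off_poly (p q : Z * Z) : bool :=
  all (fun i => seg_apart p q (v i) (v i.+1)) (iota 0 n).

(** Consecutive sides meet only in their common vertex because they are not parallel; all other
    pairs are tested by [seg_apart], except the pair closing the polygon, which is consecutive
    cyclically. *)
Definition simple_poly_check : bool :=
  [&& (3 <= n)%N, uniq (cert_poly c),
      all (fun i => orient (v i) (v i.+1) (v i.+2) != 0) (iota 0 n) &
      all (fun i => all (fun j =>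
        [|| (j <= i.+1)%N, (i == 0)%N && (j == n.-1) |
            seg_apart (v i) (v i.+1) (v j) (v j.+1)]) (iota 0 n)) (iota 0 n)].

Definition general_position_check : bool :=
  all (fun i => all (fun j => all (fun k =>
    [|| i == j, j == k, i == k | orient (pt i) (pt j) (pt k) != 0])
    (iota 0 5)) (iota 0 5)) (iota 0 5).

Definition edges_check : bool :=
  all (fun i => all (fun j =>
    (i == j) ||
    (if edge_adj (cert_edges c) i j then seg_off_poly (pt i) (pt j)
     else has (fun w => seg_cross (cert_base c) w (pt i) (pt j)) (cert_ways c)))
    (iota 0 5)) (iota 0 5).

Definition points_check : bool :=
  [&& size (cert_pts c) == 5%N, uniq (cert_pts c) & general_position_check].

(** Odd parity at the base and even parity at the vertices separate the obstacle from the vertices,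
    and from every segment off the polygon that starts at a vertex. *)
Definition parity_check : bool :=
  ray_parity v n (cert_base c) && all (fun p => ~~ ray_parity v n p) (cert_pts c).

(** The base is tested along with the ways: its degenerate segment shows that the base is off the
    polygon even if there is no way. *)
Definition obstacle_check : bool :=
  [&& points_check, simple_poly_check,
      all (seg_off_poly (cert_base c)) (cert_base c :: cert_ways c),
      parity_check & edges_check].

(** [cyc] is a closed walk in the graph, around which the base has odd parity. *)
Definition inside_check (cyc : seq nat) : bool :=
  [&& all (fun i => [&& (cyc_nth 0 cyc i < 5)%N, (cyc_nth 0 cyc i.+1 < 5)%N &
        edge_adj (cert_edges c) (cyc_nth 0 cyc i) (cyc_nth 0 cyc i.+1)])
        (iota 0 (size cyc)) &
      ray_parity (fun i => pt (cyc_nth 0%N cyc i)) (size cyc) (cert_base c)].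

(** With the base strictly to the right of all vertices, the horizontal ray from it to the right
    avoids the drawing. *)
Definition outside_check : bool :=
  all (fun p => p.1 < (cert_base c).1) (cert_pts c).

End Checks.

(** * Soundness of the integer checks over the reals *)

Section Soundness.
Variable R : realType.
Local Notation point := (R * R)%type.

Definition zr (z : Z) : R := (int_of_Z z)%:~R.
Definition zpt (p : Z * Z) : point := (zr p.1, zr p.2).

Lemma zrB : {morph zr : x y / x - y}.
Proof. by move=> x y; rewrite /zr !rmorphB. Qed.

Lemma zrM : {morph zr : x y / x * y}.
Proof. by move=> x y; rewrite /zr !rmorphM. Qed.

Lemma zr_ge0 z : (0 <= zr z) = (0 <= z).
Proof. by rewrite /zr ler0z; case: z. Qed.

Lemma zr_le : {mono zr : x y / x <= y}.
Proof. by move=> x y; rewrite -subr_ge0 -zrB zr_ge0 subr_ge0. Qed.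

Lemma zr_lt : {mono zr : x y / x < y}.
Proof. exact: leW_mono zr_le. Qed.

Lemma zr_inj : injective zr.
Proof. exact: inc_inj zr_le. Qed.

Lemma zpt_inj : injective zpt.
Proof. by move=> [a b] [a' b'] [/zr_inj -> /zr_inj ->]. Qed.

Lemma orient_zpt p q r : orient (zpt p) (zpt q) (zpt r) = zr (orient p q r).
Proof. by rewrite /orient !(zrB, zrM). Qed.

Lemma zr0 : zr 0 = 0. Proof. by []. Qed.

Lemma seg_apart_zpt p q r s :
  seg_apart (zpt p) (zpt q) (zpt r) (zpt s) = seg_apart p q r s.
Proof. by rewrite /seg_apart !orient_zpt -!zrM -zr0 !zr_lt. Qed.

Lemma seg_cross_zpt p q r s :
  seg_cross (zpt p) (zpt q) (zpt r) (zpt s) = seg_cross p q r s.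
Proof. by rewrite /seg_cross !orient_zpt -!zrM -zr0 !zr_lt. Qed.

Lemma ray_parity_zpt (v : nat -> Z * Z) n z :
  ray_parity (fun i => zpt (v i)) n (zpt z) = ray_parity v n z.
Proof.
elim: n => //= n ->; congr addb.
by rewrite /ray_crosses orient_zpt -zr0 /= !zr_le !zr_lt.
Qed.

Lemma cyc_nth_size (T : Type) (x0 : T) s : cyc_nth x0 s (size s) = cyc_nth x0 s 0.
Proof. by rewrite /cyc_nth modnn mod0n. Qed.

Variable c : certificate.
Let pt i := nth (0, 0) (cert_pts c) i.
Let n := size (cert_poly c).
Let v := cyc_nth (0, 0) (cert_poly c).
Let piece i := seg (zpt (v i)) (zpt (v i.+1)).
Let B := chain_set n piece.
Let x := zpt (cert_base c).
Let f (u : 'I_5) := zpt (pt u).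
Let adj (u w : 'I_5) := edge_adj (cert_edges c) u w.

Definition cert_obstacle : set point := connected_component (~` B) x.
Local Notation C := cert_obstacle.

Lemma seg_off_polyP p q : seg_off_poly c p q -> seg (zpt p) (zpt q) `<=` ~` B.
Proof.
move=> /allP off z zpq [i [ni zi]].
have : seg_apart (zpt p) (zpt q) (zpt (v i)) (zpt (v i.+1)).
  by rewrite seg_apart_zpt off // mem_iota.
by move/seg_apartP => e; have : (seg (zpt p) (zpt q) `&` piece i) z by []; rewrite e.
Qed.

Lemma simple_poly_checkP : simple_poly_check c ->
  simple_polygon [seq zpt p | p <- cert_poly c] B.
Proof.
move=> /and4P[n3 un /allP adjn /allP far].
have zv i : nth (0, 0) [seq zpt p | p <- cert_poly c] (i %% n) = zpt (v i).
  by rewrite (nth_map (0, 0)) // ltn_mod (leq_trans _ n3).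
rewrite /simple_polygon size_map -/n; split => //.
- by rewrite map_inj_uniq //; exact: zpt_inj.
- move=> i j /andP[ij jn]; rewrite !zv -!/(piece _).
  have adjP k : (k < n)%N -> piece k `&` piece k.+1 = [set zpt (v k.+1)].
    move=> kn; apply: seg_adjacent; rewrite orient_zpt -zr0 (inj_eq zr_inj).
    by rewrite adjn // mem_iota.
  have [->|ji] := eqVneq j i.+1; first by apply: adjP; exact: ltn_trans ij jn.
  (* The first and last sides: by cyclic indexing side 0 is also the side after [j], so the
     consecutive case applies. *)
  have [/andP[/eqP i0 /eqP jE]|ij0] /= := boolP ((i == 0)%N && (j == n.-1)).
    have jn' : j.+1 = n by rewrite jE prednK // (leq_trans _ n3).
    have n1 : (1 %% n = 1)%N by rewrite modn_small // (leq_trans _ n3).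
    have vn : v j.+1 = v 0%N by rewrite jn' /v cyc_nth_size.
    have vn1 : v j.+2 = v 1%N by rewrite jn' /v /cyc_nth -addn1 -/n modnDl.
    by rewrite setIC i0 -adjP // /piece vn vn1.
  have := far i; rewrite mem_iota (ltn_trans ij jn) => /(_ isT) /allP /(_ j).
  rewrite mem_iota jn => /(_ isT) /or3P[ji'|e|ap].
  + by move: ji' ij ji; rewrite leq_eqVlt => /orP[-> //|]; rewrite ltnS leqNgt => /negP.
  + by rewrite e in ij0.
  + by apply: seg_apartP; rewrite seg_apart_zpt.
by congr (chain_set n _); apply/funext => i; rewrite !zv.
Qed.

Hypothesis ok : obstacle_check c.

Lemma cert_base_off : (~` B) x.
Proof.
case/and5P: ok => _ _ /allP off _ _.
by apply: (seg_off_polyP (off _ (mem_head _ _))); exact: seg_left.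
Qed.

Lemma cert_obstacle_obstacle : obstacle C.
Proof.
case/and5P: ok => _ sp _ _ _.
split.
  apply: connected_component_open; apply: closed_openC; apply: chain_set_closed.
  by move=> i; exact: seg_closed.
exists B; split; last by exists x; split => //; exact: cert_base_off.
by left; exists [seq zpt p | p <- cert_poly c]; exact: simple_poly_checkP.
Qed.

Lemma cert_obstacle_parity z : C z -> ray_parity (fun i => zpt (v i)) n z.
Proof.
move=> Cz; case/and5P: ok => _ _ _ /andP[px _] _.
have vn : zpt (v n) = zpt (v 0%N) by rewrite /v cyc_nth_size.
rewrite (@ray_parity_connected _ C _ _ z x) //; first by rewrite ray_parity_zpt.
- exact: component_connected.
- exact: connected_component_sub.
- exact/connected_component_refl/cert_base_off.
Qed.

Lemma cert_pts_mem (u : 'I_5) : pt u \in cert_pts c.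
Proof. by case/and5P: ok => /and3P[/eqP s5 _ _] _ _ _ _; rewrite mem_nth // s5. Qed.

Lemma cert_pts_parity (u : 'I_5) : ray_parity (fun i => zpt (v i)) n (f u) = false.
Proof.
case/and5P: ok => _ _ _ /andP[_ /allP pp] _.
by rewrite ray_parity_zpt; apply/negbTE/pp/cert_pts_mem.
Qed.

Lemma cert_obstacle_rep : obstacle_rep adj f C.
Proof.
case/and5P: (ok) => /and3P[/eqP s5 up /allP gp] _ /allP off _ /allP ed.
have mi (u : 'I_5) : val u \in iota 0 5 by rewrite mem_iota /=.
split; first exact: cert_obstacle_obstacle.
- split.
    move=> u w /zpt_inj /eqP; rewrite nth_uniq ?s5 // => /eqP; exact: val_inj.
  move=> u w t uw wt ut; rewrite /collinear -/(orient _ _ _) orient_zpt -zr0.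
  move=> /zr_inj e; have := gp _ (mi u) => /allP /(_ _ (mi w)) /allP /(_ _ (mi t)).
  by rewrite !val_eqE (negPf uw) (negPf wt) (negPf ut) /= -/(pt u) e eqxx.
- by move=> u /cert_obstacle_parity; rewrite cert_pts_parity.
move=> u w uw; have := ed _ (mi u) => /allP /(_ _ (mi w)); rewrite val_eqE (negPf uw).
rewrite orFb -/(adj u w); case: (adj u w) => [offuw|/hasP[p pw cr]]; split => //.
  (* The edge avoids the polygon, so its points have the even parity of [f u], whereas points of the
     obstacle have odd parity. *)
  move=> _; rewrite -subset0 => z [zuw /cert_obstacle_parity].
  have vn : zpt (v n) = zpt (v 0%N) by rewrite /v cyc_nth_size.
  rewrite (@ray_parity_connected _ (seg (f u) (f w)) _ _ z (f u)) ?cert_pts_parity //.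
  - exact: seg_connected.
  - exact: seg_off_polyP.
  - exact: seg_left.
(* The segment from the base to [p] stays in the obstacle, so its crossing with the non-edge is an
   obstacle point. *)
move=> e; have : seg_cross x (zpt p) (f u) (f w) by rewrite seg_cross_zpt.
move=> /seg_crossP[z zxp zuw].
suff : (seg (f u) (f w) `&` C) z by rewrite e.
split => //; apply: (@seg_connected_component _ _ _ x (zpt p)) => //.
  exact/connected_component_refl/cert_base_off.
by apply/seg_off_polyP/off; rewrite in_cons pw orbT.
Qed.

(** The closed walk is part of the drawing, so its parity is constant on the obstacle and on each
    face. A face meeting the obstacle therefore has odd parity throughout, hence is bounded. *)
Lemma inside_checkP cyc : inside_check c cyc -> has_inside_obstacle_rep R adj.
Proof.
move=> /andP[/allP walk par]; exists f, C; split; first exact: cert_obstacle_rep.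
pose w i := zpt (pt (cyc_nth 0%N cyc i)).
have wn : w (size cyc) = w 0%N by rewrite /w cyc_nth_size.
have wD : chain_set (size cyc) (fun i => seg (w i) (w i.+1)) `<=` drawing adj f.
  move=> z [i [ic zi]]; have := walk i; rewrite mem_iota => /(_ ic) /and3P[i5 j5 ij].
  by exists (Ordinal i5), (Ordinal j5); split; rewrite // /adj /= ij orbT.
have CD : C `<=` ~` drawing adj f by exact/obstacle_rep_drawing/cert_obstacle_rep.
move=> y Cy [nDy]; apply.
have [M MP] := ray_parity_bounded wn.
exists M => z yz; apply: MP => /=.
have sub (A : set point) : A `<=` ~` drawing adj f ->
    A `<=` ~` chain_set (size cyc) (fun i => seg (w i) (w i.+1)).
  by move=> AD t At /wD; exact: AD.
rewrite (@ray_parity_connected _ (connected_component (~` drawing adj f) y) _ _ z y) //.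
- rewrite (@ray_parity_connected _ C _ _ y x) // ?ray_parity_zpt //.
  + exact: component_connected.
  + exact: sub.
  + exact/connected_component_refl/cert_base_off.
- exact: component_connected.
- by apply: sub; exact: connected_component_sub.
- exact: connected_component_refl.
Qed.

Lemma outside_checkP : outside_check c -> has_outside_obstacle_rep R adj.
Proof.
move=> /allP right; exists f, C; split; first exact: cert_obstacle_rep.
have CD : C `<=` ~` drawing adj f by exact/obstacle_rep_drawing/cert_obstacle_rep.
have Cx : C x by exact/connected_component_refl/cert_base_off.
have Dx z : drawing adj f z -> z.1 < x.1.
  have fx u : (f u).1 < x.1 by rewrite zr_lt right // cert_pts_mem.
  move=> [u [w [_ [t [/andP[t0 t1] ->]]]]].
  move: (x.1) (f u) (f w) (fx u) (fx w) => X a b aX bX /=.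
  have -> : X = (1 - t) * X + t * X by ring.
  have [->|t_neq0] := eqVneq t 0.
    by rewrite subr0 !mul1r !mul0r !addr0.
  apply: ler_ltD; first by rewrite ler_wpM2l ?subr_ge0 // ltW.
  by rewrite ltr_pM2l // lt_neqAle eq_sym t_neq0.
move=> y Cy; split; first exact: CD.
have xy : connected_component (~` drawing adj f) x y.
  by apply: (@connected_component_max _ _ C) => //; exact: component_connected.
rewrite -(same_connected_component xy).
apply: (@unbounded_ray _ _ _ (1, 0)); first by rewrite xpair_eqE oner_eq0.
by move=> t t0 /Dx /=; rewrite mulr1 gtrDl ltNge t0.
Qed.

End Soundness.

(** * Enumeration of the graphs on five vertices *)

Section Isomorphism.
Variables (R : realType) (V W : finType) (a : rel V) (b : rel W).

Lemma graph_iso_sym : graph_iso a b -> graph_iso b a.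
Proof.
move=> [h [[g hg gh] ab]]; exists g; split; first by exists h.
by move=> u v; rewrite -ab !gh.
Qed.

Lemma graph_iso_cycle : graph_iso a b -> has_cycle a -> has_cycle b.
Proof.
move=> [h [hb ab]] [s [s3 [us cs]]]; exists (map h s); split; first by rewrite size_map.
split; first by rewrite map_inj_uniq //; exact: bij_inj.
case: s cs {us s3} => //= x s; rewrite -map_rcons path_map.
by apply: sub_path => u v; rewrite /= ab.
Qed.

Variable h : V -> W.
Hypotheses (hb : bijective h) (hab : forall u v, b (h u) (h v) = a u v).

Lemma obstacle_rep_iso (f : W -> R * R) C :
  obstacle_rep b f C -> obstacle_rep a (f \o h) C.
Proof.
have hi := bij_inj hb; move=> [oC [fi gp] fC eC]; split => //.
- split; first exact: inj_comp.
  by move=> u v w uv vw uw; apply: gp; rewrite inj_eq.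
- by move=> u; exact: fC.
- by move=> u v uv; rewrite -hab; apply: eC; rewrite inj_eq.
Qed.

Lemma drawing_iso (f : W -> R * R) : drawing a (f \o h) = drawing b f.
Proof.
have hi := bij_inj hb; have [g hg gh] := hb.
apply/seteqP; split=> z /= [u [v [uv zuv]]].
  by exists (h u), (h v); rewrite inj_eq // hab.
exists (g u), (g v); rewrite -hab /= !gh; split => //.
by rewrite (can_eq gh).
Qed.

End Isomorphism.

Lemma graph_iso_inside (R : realType) (V W : finType) (a : rel V) (b : rel W) :
  graph_iso a b -> has_inside_obstacle_rep R b -> has_inside_obstacle_rep R a.
Proof.
move=> [h [hb hab]] [f [C [rep inC]]]; exists (f \o h), C.
split; first exact: obstacle_rep_iso hab _ _ rep.
by rewrite /in_unbounded_face (drawing_iso hb hab).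
Qed.

Lemma graph_iso_outside (R : realType) (V W : finType) (a : rel V) (b : rel W) :
  graph_iso a b -> has_outside_obstacle_rep R b -> has_outside_obstacle_rep R a.
Proof.
move=> [h [hb hab]] [f [C [rep outC]]]; exists (f \o h), C.
split; first exact: obstacle_rep_iso hab _ _ rep.
by rewrite /in_unbounded_face (drawing_iso hb hab).
Qed.

(** A graph on five vertices is encoded by filtering this list, so equal graphs have equal edge
    lists. *)
Definition pairs5 : seq (nat * nat) :=
  [seq e <- [seq (i, j) | i <- iota 0 5, j <- iota 0 5] | (e.1 < e.2)%N].

Lemma mem_pairs5 i j : ((i, j) \in pairs5) = (i < j < 5)%N.
Proof.
rewrite mem_filter -[((i, j).1 < (i, j).2)%N]/(i < j)%N.
have [ij|//] := ltnP i j.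
apply/allpairsP/idP => [[[i' j'] []]|j5].
  by rewrite !mem_iota => _ j5 [_ ->].
by exists (i, j); rewrite !mem_iota; split => //; exact: ltn_trans ij j5.
Qed.

Fixpoint sublists (T : Type) (s : seq T) : seq (seq T) :=
  if s is x :: s' then let r := sublists s' in r ++ [seq x :: t | t <- r]
  else [:: [::]].

Lemma filter_sublists (T : eqType) (P : pred T) (s : seq T) :
  [seq x <- s | P x] \in sublists s.
Proof.
elim: s => //= x s IH; rewrite mem_cat; case: (P x); last by rewrite IH.
by rewrite map_f ?orbT.
Qed.

Fixpoint words (k n : nat) : seq (seq nat) :=
  if n is m.+1 then [seq x :: s | x <- iota 0 k, s <- words k m] else [:: [::]].

Lemma mem_words k (s : seq nat) : all (gtn k) s -> s \in words k (size s).
Proof.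
elim: s => //= x s IH /andP[xk sk]; apply: allpairs_f; last exact: IH.
by rewrite mem_iota.
Qed.

Definition cycle_words : seq (seq nat) :=
  [seq s <- words 5 3 ++ words 5 4 ++ words 5 5 | uniq s].

Definition edge_cyclic (E : seq (nat * nat)) : bool :=
  has (cycle (edge_adj E)) cycle_words.

(** The new vertex [i] stands for [nth 0 p i] in [F]. The result has the normal form of [edge_list],
    so isomorphism is tested by membership of lists. *)
Definition relabel (F : seq (nat * nat)) (p : seq nat) : seq (nat * nat) :=
  [seq e <- pairs5 | edge_adj F (nth 0%N p e.1) (nth 0%N p e.2)].

Definition relabellings (F : seq (nat * nat)) : seq (seq (nat * nat)) :=
  [seq relabel F p | p <- permutations (iota 0 5)].

Lemma edge_adjC E i j : edge_adj E i j = edge_adj E j i.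
Proof. by rewrite /edge_adj orbC. Qed.

Lemma edge_adj_filter_pairs5 (P : nat -> nat -> bool) i j :
  (forall i j, P i j = P j i) -> (forall i, P i i = false) ->
  (i < 5)%N -> (j < 5)%N ->
  edge_adj [seq e <- pairs5 | P e.1 e.2] i j = P i j.
Proof.
move=> Ps Pi i5 j5; rewrite /edge_adj mem_filter mem_pairs5 mem_filter mem_pairs5 /= i5 j5 !andbT.
rewrite (Ps j i) -andb_orr -neq_ltn; have [->|] := eqVneq i j; last by rewrite andbT.
by rewrite Pi.
Qed.

Definition edge_list (adj : rel 'I_5) : seq (nat * nat) :=
  [seq e <- pairs5 | adj (inord e.1) (inord e.2)].

Lemma edge_listP (adj : rel 'I_5) : simple_graph adj ->
  forall u v : 'I_5, edge_adj (edge_list adj) u v = adj u v.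
Proof.
move=> [sym irr] u v; rewrite (edge_adj_filter_pairs5 (P := fun i j => adj (inord i) (inord j))) //.
  by rewrite !inord_val.
Qed.

Lemma relabelling_iso (adj : rel 'I_5) (F : seq (nat * nat)) :
  simple_graph adj -> (forall i, edge_adj F i i = false) ->
  edge_list adj \in relabellings F ->
  graph_iso adj (fun u v : 'I_5 => edge_adj F u v).
Proof.
move=> sg irr /mapP[p]; rewrite mem_permutations => pp EF.
have sp : size p = 5%N by rewrite (perm_size pp) size_iota.
have up : uniq p by rewrite (perm_uniq pp) iota_uniq.
have p5 (u : 'I_5) : (nth 0%N p u < 5)%N.
  have : nth 0%N p u \in p by rewrite mem_nth // sp.
  by rewrite (perm_mem pp) mem_iota.
exists (fun u => Ordinal (p5 u)); split.
  apply: injF_bij => u v [/eqP]; rewrite nth_uniq ?sp // => /eqP; exact: val_inj.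
move=> u v /=; rewrite -(edge_listP sg) EF /relabel.
rewrite (edge_adj_filter_pairs5
  (P := fun i j => edge_adj F (nth 0%N p i) (nth 0%N p j))) //.
by move=> i j; rewrite edge_adjC.
Qed.

Lemma has_cycle_edge_cyclic (adj : rel 'I_5) :
  simple_graph adj -> has_cycle adj -> edge_cyclic (edge_list adj).
Proof.
move=> sg [s [s3 [us cs]]]; pose t : seq nat := [seq nat_of_ord u | u <- s].
have := max_card (mem s); rewrite (card_uniqP us) card_ord => s5.
have tw : t \in words 5 (size s).
  rewrite -(size_map (@nat_of_ord 5)); apply: mem_words.
  by apply/allP => i /mapP[u _ ->] /=.
have ut : uniq t by rewrite map_inj_uniq //; exact: ord_inj.
apply/hasP; exists t.
  rewrite mem_filter ut andTb mem_cat [X in _ || X]mem_cat.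
  move: (size s) tw s3 s5.
  by case=> [|[|[|[|[|[|k]]]]]] // -> _ _; rewrite ?orbT.
clear tw ut; rewrite {}/t.
case: s cs {us s3 s5} => //= x s; rewrite -map_rcons path_map.
by apply: sub_path => u v /=; rewrite edge_listP.
Qed.

Definition K23_edges : seq (nat * nat) :=
  [:: (0, 2); (0, 3); (0, 4); (1, 2); (1, 3); (1, 4)]%N.

Lemma K23_edgesE (u v : 'I_5) : edge_adj K23_edges u v = K23 u v.
Proof.
by case: u v => [[|[|[|[|[|u]]]]] ?] [[|[|[|[|[|v]]]]] ?].
Qed.

(** * Explicit representations *)

Section CertificateData.
Local Open Scope Z_scope.

(** One entry for each isomorphism type with a cycle other than K_{2,3}, by increasing number of
    edges; the second component is the closed walk around the base. *)
Definition inside_certs : seq (certificate * seq nat) :=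
  (Certificate [:: (0, 1); (0, 2); (1, 2)]%N
    [:: (21, 0); (50, 35); (8, 47); (27, 29); (23, 37)]
    [:: (38, 37); (20, 20); (26, 34); (15, 44); (19, 16)]
    (19, 18) [:: (37, 36); (25, 34); (16, 43)],
   [:: 0; 1; 2]%N) ::
  (Certificate [:: (0, 1); (0, 2); (0, 3); (1, 2)]%N
    [:: (5, 15); (99, 10); (75, 64); (30, 21); (51, 34)]
    [:: (67, 13); (52, 46); (54, 24); (28, 28)]
    (57, 21) [:: (66, 14); (53, 43); (31, 27)],
   [:: 0; 1; 2]%N) ::
  (Certificate [:: (0, 1); (0, 2); (1, 2); (3, 4)]%N
    [:: (1, 24); (16, 0); (28, 14); (17, 13); (13, 13)]
    [:: (24, 15); (14, 7); (6, 22); (14, 4)]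
    (14, 6) [:: (23, 14); (7, 20)],
   [:: 0; 1; 2]%N) ::
  (Certificate [:: (0, 1); (0, 2); (1, 3); (2, 3)]%N
    [:: (2, 10); (11, 7); (34, 32); (35, 20); (21, 16)]
    [:: (16, 10); (21, 17); (31, 18); (19, 20)]
    (19, 19) [:: (17, 12); (29, 18)],
   [:: 0; 1; 3; 2]%N) ::
  (Certificate [:: (0, 1); (0, 2); (0, 3); (0, 4); (1, 2)]%N
    [:: (70, 56); (38, 60); (14, 0); (56, 49); (49, 56)]
    [:: (55, 42); (53, 54); (42, 59); (51, 45)]
    (53, 45) [:: (52, 54); (44, 58)],
   [:: 0; 2; 1]%N) ::
  (Certificate [:: (0, 1); (0, 2); (0, 3); (1, 2); (1, 3)]%N
    [:: (0, 21); (20, 20); (12, 22); (10, 6); (12, 18)]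
    [:: (12, 9); (11, 18); (18, 19); (4, 20)]
    (10, 19) [:: (11, 11); (17, 19)],
   [:: 0; 3; 1]%N) ::
  (Certificate [:: (0, 1); (0, 2); (0, 3); (1, 2); (1, 4)]%N
    [:: (22, 7); (1, 8); (13, 21); (16, 10); (12, 10)]
    [:: (15, 8); (16, 16); (11, 14)]
    (12, 13) [:: (15, 9); (15, 15)],
   [:: 0; 2; 1]%N) ::
  (Certificate [:: (0, 1); (0, 2); (0, 3); (1, 2); (3, 4)]%N
    [:: (22, 0); (8, 32); (4, 2); (11, 13); (13, 6)]
    [:: (7, 3); (20, 2); (11, 7); (10, 25)]
    (9, 6) [:: (18, 3); (10, 24)],
   [:: 0; 1; 2]%N) ::
  (Certificate [:: (0, 1); (0, 2); (0, 3); (1, 4); (2, 4)]%N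
    [:: (18, 18); (17, 5); (1, 18); (13, 14); (0, 5)]
    [:: (16, 10); (7, 17); (11, 8)]
    (11, 9) [:: (15, 10); (8, 16)],
   [:: 0; 1; 4; 2]%N) ::
  (Certificate [:: (0, 1); (0, 2); (1, 3); (2, 4); (3, 4)]%N
    [:: (7, 7); (3, 2); (7, 15); (0, 10); (2, 14)]
    [:: (4, 14); (1, 8); (6, 6)]
    (5, 8) [:: (4, 13); (2, 9)],
   [:: 0; 1; 3; 4; 2]%N) ::
  (Certificate [:: (0, 1); (0, 2); (0, 3); (0, 4); (1, 2); (1, 3)]%N
    [:: (22, 2); (5, 0); (23, 26); (9, 0); (15, 7)]
    [:: (12, 1); (20, 18); (11, 6)]
    (12, 6) [:: (12, 2); (19, 16)],
   [:: 0; 2; 1; 3]%N) ::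
  (Certificate [:: (0, 1); (0, 2); (0, 3); (0, 4); (1, 2); (3, 4)]%N
    [:: (13, 28); (18, 10); (18, 8); (14, 0); (32, 7)]
    [:: (14, 2); (26, 11); (25, 14)]
    (25, 11) [:: (15, 3)],
   [:: 0; 4; 3]%N) ::
  (Certificate [:: (0, 1); (0, 2); (0, 3); (1, 2); (1, 3); (2, 3)]%N
    [:: (2, 5); (19, 7); (2, 8); (3, 15); (7, 10)]
    [:: (3, 9); (15, 8); (3, 13); (8, 10)]
    (9, 10) [:: (4, 9); (5, 12)],
   [:: 0; 2; 3; 1]%N) ::
  (Certificate [:: (0, 1); (0, 2); (0, 3); (1, 2); (1, 3); (2, 4)]%N
    [:: (0, 9); (14, 19); (22, 3); (7, 16); (9, 11)]
    [:: (3, 9); (16, 14); (14, 15)]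
    (14, 14) [:: (5, 10)],
   [:: 0; 2; 1]%N) ::
  (Certificate [:: (0, 1); (0, 2); (0, 3); (1, 2); (1, 4); (3, 4)]%N
    [:: (0, 0); (0, 7); (5, 8); (12, 10); (11, 14)]
    [:: (10, 9); (5, 10); (4, 8)]
    (5, 9) [:: (9, 9)],
   [:: 0; 3; 4; 1]%N) ::
  (Certificate [:: (0, 1); (0, 2); (0, 3); (0, 4); (1, 2); (1, 3); (1, 4)]%N
    [:: (64, 22); (37, 1); (16, 66); (37, 23); (44, 28)]
    [:: (42, 23); (37, 46); (25, 45)]
    (37, 44) [:: (41, 25); (26, 44)],
   [:: 0; 3; 1; 2]%N) ::
  (Certificate [:: (0, 1); (0, 2); (0, 3); (0, 4); (1, 2); (1, 3); (2, 3)]%N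
    [:: (12, 1); (23, 23); (23, 18); (4, 13); (12, 9)]
    [:: (17, 12); (6, 11); (10, 8)]
    (11, 9) [:: (15, 11)],
   [:: 0; 1; 2; 3]%N) ::
  (Certificate [:: (0, 1); (0, 2); (0, 3); (0, 4); (1, 2); (1, 3); (2, 4)]%N
    [:: (4, 1); (7, 9); (1, 7); (8, 6); (2, 4)]
    [:: (4, 3); (5, 8); (3, 7)]
    (4, 7) [:: (4, 4)],
   [:: 0; 3; 1; 2]%N) ::
  (Certificate [:: (0, 1); (0, 2); (0, 3); (1, 2); (1, 3); (2, 4); (3, 4)]%N
    [:: (5, 11); (3, 10); (15, 1); (1, 5); (5, 0)]
    [:: (3, 3); (8, 6); (5, 6)]
    (6, 5) [:: (4, 4)],
   [:: 0; 1; 2; 4; 3]%N) ::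
  (Certificate [:: (0, 1); (0, 2); (0, 3); (0, 4); (1, 2); (1, 3); (1, 4); (2, 3)]%N
    [:: (1, 1); (10, 11); (5, 10); (0, 7); (6, 6)]
    [:: (3, 5); (7, 8); (6, 9)]
    (6, 8) [:: (4, 6)],
   [:: 0; 1; 3]%N) ::
  (Certificate [:: (0, 1); (0, 2); (0, 3); (0, 4); (1, 2); (1, 3); (2, 4); (3, 4)]%N
    [:: (9, 7); (0, 0); (8, 0); (4, 5); (9, 3)]
    [:: (2, 1); (8, 2); (5, 3)]
    (5, 2) [:: (7, 2)],
   [:: 0; 2; 1; 3]%N) ::
  (Certificate [:: (0, 1); (0, 2); (0, 3); (0, 4); (1, 2); (1, 3); (1, 4); (2, 3); (2, 4)]%N
    [:: (2, 10); (9, 3); (8, 2); (3, 0); (6, 8)]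
    [:: (4, 1); (5, 5); (3, 4)]
    (4, 3) [:: (4, 2)],
   [:: 0; 1; 3]%N) ::
  (Certificate [:: (0, 1); (0, 2); (0, 3); (0, 4); (1, 2); (1, 3); (1, 4); (2, 3); (2, 4); (3, 4)]%N
    [:: (2, 2); (7, 1); (6, 8); (7, 0); (0, 5)]
    [:: (6, 5); (4, 4); (5, 3)]
    (5, 4) [::],
   [:: 0; 1; 2]%N) ::
  [::].

(** The three ways reach, in this order, across the non-edge 01, across 23, and across both 34 and
    24. *)
Definition K23_outside_cert : certificate :=
  Certificate K23_edges
    [:: (0, 0); (43, 27); (0, 135); (34, 114); (66, 60)]
    [:: (9, 7); (150, 70); (5, 131); (111, 77); (38, 79); (110, 66)]
    (130, 70) [:: (15, 10); (11, 128); (45, 78)].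

End CertificateData.

Lemma inside_certs_check :
  all (fun d => [&& obstacle_check d.1, inside_check d.1 d.2 &
    all (fun e => e.1 != e.2) (cert_edges d.1)]) inside_certs.
Proof. by vm_compute. Qed.

Lemma K23_outside_check :
  obstacle_check K23_outside_cert && outside_check K23_outside_cert.
Proof. by vm_compute. Qed.

Definition covered_graphs : seq (seq (nat * nat)) :=
  flatten [seq relabellings (cert_edges d.1) | d <- inside_certs].

Definition K23_graphs : seq (seq (nat * nat)) := relabellings K23_edges.

(** Exhaustion over all 1024 graphs on five labelled vertices. *)
Lemma cyclic_graphs_check :
  all (fun E => edge_cyclic E ==> (E \in covered_graphs) || (E \in K23_graphs))
    (sublists pairs5).
Proof. by vm_compute. Qed.

(* Unlike [flatten_mapP], this does not need an [eqType] structure on [S]. *)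
Lemma flatten_map_all (S : Type) (T : eqType) (Q : pred S) (F : S -> seq T) s y :
  all Q s -> y \in flatten [seq F d | d <- s] -> exists2 d, Q d & y \in F d.
Proof.
elim: s => //= d s IH /andP[Qd Qs]; rewrite mem_cat => /orP[yd|].
  by exists d.
exact: IH.
Qed.

Lemma edge_adj_irreflexive E i :
  all (fun e => e.1 != e.2) E -> edge_adj E i i = false.
Proof.
move=> /allP irr; rewrite /edge_adj orbb.
by apply/negP => /irr; rewrite eqxx.
Qed.

Theorem theorem8 (R : realType) (adj : rel 'I_5) :
  simple_graph adj ->
  ((has_cycle adj /\ has_outside_obstacle_rep R adj /\
    ~ has_inside_obstacle_rep R adj) <-> graph_iso adj K23).
Proof.
move=> sg; have K23E : (fun u v : 'I_5 => edge_adj K23_edges u v) = K23.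
  by apply/funext => u; apply/funext => v; exact: K23_edgesE.
split=> [[cyc [_ ninside]]|iso].
  have := allP cyclic_graphs_check _ (filter_sublists _ _ : edge_list adj \in _).
  rewrite has_cycle_edge_cyclic // implyTb => /orP[cov|].
    have [d /and3P[ok inc irr]] := flatten_map_all
      (F := fun d => relabellings (cert_edges d.1)) inside_certs_check cov.
    move=> /(relabelling_iso sg (fun i => edge_adj_irreflexive i irr)) iso.
    case: ninside; apply: graph_iso_inside iso _; exact: inside_checkP inc.
  by rewrite -K23E; apply: relabelling_iso => // i; exact: edge_adj_irreflexive.
split.
  apply: (graph_iso_cycle (graph_iso_sym iso)).
  (* A 4-cycle alternating between the two sides of K_{2,3}. *)
  by exists [:: inord 0; inord 2; inord 1; inord 3]; rewrite /= !inE -!val_eqE /K23 /= !inordK.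
split.
  apply: graph_iso_outside iso _; rewrite -K23E.
  by have /andP[ok out] := K23_outside_check; exact: (outside_checkP R ok out).
move=> /(graph_iso_inside (graph_iso_sym iso)).
exact: K23_no_inside_obstacle_rep.
Qed.
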